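(* Let $\mathcal{H}$ be an $r$-uniform hypergraph on $n$ vertices, let $0<\gamma<1$ and let $\ell$ be a positive integer. Then there exist a positive integer $t = t(\mathcal{H},\ell,\gamma,r)$ and an $r$-uniform hypergraph $\mathcal{G}$ with vertex set $V(\mathcal{H})\times[t]$ with the following properties: (1) for every hyperedge $\{a_1,\dots,a_r\}\in\mathcal{H}$ and all sets $U_i\subseteq\{a_i\}\times[t]$ with $|U_i|\geq\gamma t$ for each $1\le i\le r$, there exists at least one hyperedge of $\mathcal{G}$ with one vertex in each $U_i$; (2) $\mathcal{G}$ does not contain as a subhypergraph any hypergraph $\mathcal{F}$ with $v$ vertices and $m$ hyperedges where $v\le\ell$ and $v + (1+\gamma-r)(m-1) < r$.
   Context: $[t]=\{1,\dots,t\}$.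
   Formalization: In property (2) the hypergraph F is required to have at least one hyperedge (m ≥ 1); for m = 0 and v = 1 the inequality holds, yet every G with a vertex contains a single isolated vertex, so the claim as printed fails. *)

(* Defs.v *)
From mathcomp Require Import all_boot all_order all_algebra.
From mathcomp Require Import reals.

Set Implicit Arguments.
Unset Strict Implicit.
Unset Printing Implicit Defensive.

(* A hypergraph with vertex set V is identified with its set of hyperedges,
   an element of {set {set V}}. Vertices may be isolated; the number of
   vertices is #|V| and the number of hyperedges is #|E|. *)
Definition hypergraph (V : finType) := {set {set V}}.

Definition uniform (r : nat) (V : finType) (E : hypergraph V) : Prop :=
  forall e : {set V}, e \in E -> #|e| = r.

(* G contains a (not necessarily induced) copy of F. *)
Definition contains (V W : finType) (G : hypergraph V) (F : hypergraph W) :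
    Prop :=
  exists f : W -> V,
    injective f /\ (forall e : {set W}, e \in F -> f @: e \in G).

(* Main.v *)
Require Import Defs.
From mathcomp Require Import all_boot all_order all_algebra.
From mathcomp Require Import reals.
From mathcomp Require Import zify ring lra.

(* Deletion method.  Put t = s^k with k gamma > 2 and draw s t independent
   uniformly random r-tuples of vertices of V x [t].  For order v and m >= 2
   hyperedges subject to v + (1 + 2/k - r)(m - 1) < r, the expected number of
   pairs (v vertices, m indices of tuples lying on them) is O(t / s).  A family
   (U_1, ..., U_r) is met by a fixed positive proportion q of all tuples, so it
   is met at most t times with probability at most 2^t (1 - q/2)^(s t), which
   for large s beats the 2^(n r t) families.  Hence some outcome has fewer than
   t forbidden pairs while every family is met more than t times, and deleting
   one index from each pair leaves the required hypergraph.  Tuples that repeat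
   a vertex are discarded; a family over a hyperedge of H is met only by
   injective tuples, as its members lie in distinct fibres.  A forbidden
   hypergraph with one hyperedge has fewer than r vertices. *)

Set Implicit Arguments.
Unset Strict Implicit.
Unset Printing Implicit Defensive.

Import Order.TTheory GRing.Theory Num.Theory.
Local Open Scope ring_scope.

(** * Averaging, Bernoulli's inequality and counting functions *)

Lemma exists_lt1_of_sum_lt (R : realDomainType) (I : finType) (F : I -> R) :
  \sum_i F i < #|I|%:R -> exists i, F i < 1.
Proof.
move=> lt_sum; apply/existsP; apply: contraTT lt_sum => /existsPn ge1.
rewrite -leNgt -[#|I|]sum1_card natr_sum; apply: ler_sum => i _.
by rewrite leNgt.
Qed.

(** The induction step rests on [(1 - x) * (1 + (s + 1) * x) <= 1 + s * x]. *)
Lemma expr_onem_bernoulli (R : realDomainType) (x : R) (s : nat) :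
  0 <= x -> x <= 1 -> (1 - x) ^+ s * (1 + s%:R * x) <= 1.
Proof.
move=> x0 x1; elim: s => [|s IH]; first by rewrite expr0 mul0r addr0 mulr1.
apply: le_trans IH; rewrite exprSr -mulrA.
apply: ler_wpM2l; first by rewrite exprn_ge0 // subr_ge0.
rewrite -natr1; have : 0 <= s%:R * x ^+ 2 by rewrite mulr_ge0 ?sqr_ge0.
have := sqr_ge0 x; nra.
Qed.

Lemma leq_expl (m n e : nat) : (m <= n)%N -> (m ^ e <= n ^ e)%N.
Proof. by case: e => // e; rewrite leq_exp2r. Qed.

Lemma leq_bin_exp (n m : nat) : ('C(n, m) <= n ^ m)%N.
Proof.
have [|lt_nm] := leqP m n; last by rewrite bin_small.
elim: m => [|m IH] le_mn; first by rewrite bin0.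
rewrite expnS -(leq_pmul2l (ltn0Sn m)) mul_bin_left mulnA.
apply: leq_mul; last exact: IH (ltnW le_mn).
nia.
Qed.

Lemma card_ffun_maps_to (I T : finType) (J : {set I}) (B : {set T}) :
  #|[set f : {ffun I -> T} | [forall j in J, f j \in B]]|
    = (#|B| ^ #|J| * #|T| ^ (#|I| - #|J|))%N.
Proof.
pose D (i : I) := if i \in J then [pred x | x \in B] else predT.
rewrite cardsE (@eq_card _ _ (family D)); last first.
  move=> f; rewrite unfold_in; apply/forall_inP/familyP => fB i.
    by rewrite /D; case: ifP => // /fB.
  by move=> iJ; have := fB i; rewrite /D iJ.
rewrite card_family foldrE big_map big_enum /= (bigID (mem J)) /=.
rewrite (eq_bigr (fun=> #|B|)) => [|i iJ]; last by rewrite /D iJ.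
rewrite prod_nat_const; congr (_ * _)%N.
rewrite (eq_bigr (fun=> #|T|)) => [|i /negbTE iJ]; last by rewrite /D iJ.
by rewrite prod_nat_const -(cardC J) addKn.
Qed.

(** The weight is a product over [I] of factors 1/2 on [B] and 1 off [B], so the sum over all
    functions factorises. *)
Lemma sum_halfX_hits (R : numFieldType) (I T : finType) (B : {set T}) :
  \sum_(f : {ffun I -> T}) (2^-1 : R) ^+ #|[set i | f i \in B]|
    = (#|T|%:R - #|B|%:R / 2) ^+ #|I|.
Proof.
pose w x : R := if x \in B then 2^-1 else 1.
have -> : #|T|%:R - #|B|%:R / 2 = \sum_x w x.
  rewrite (bigID (mem B)) /= -[#|T|](cardsC B) -!sum1_card !natr_sum.
  rewrite mulr_suml natrD !natr_sum addrAC -sumrB.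
  congr (_ + _); last by apply: eq_big => [x|x]; rewrite ?inE // /w => /negbTE->.
  by apply: eq_bigr => x xB; rewrite /w xB; field.
rewrite -prodr_const bigA_distr_bigA /=; apply: eq_bigr => f _.
rewrite (bigID (fun i => f i \in B)) /= [X in _ * X]big1 ?mulr1; last first.
  by move=> i /negbTE; rewrite /w => ->.
rewrite -prodr_const; apply: eq_big => [i|i]; first by rewrite inE.
by rewrite inE /w => ->.
Qed.

Lemma delete_one_each (I K : finType) (P : {set K}) (g : K -> {set I}) :
  (forall p, p \in P -> g p != set0) ->
  exists2 J : {set I}, (#|~: J| <= #|P|)%N
    & forall p, p \in P -> ~~ (g p \subset J).
Proof.
move=> g0.
(* The default index [i0] needs [I] inhabited; if [I] is empty, then so is [P], because each [g p]
   is nonempty. *)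
case: (pickP I) => [i0 _|I0]; last first.
  exists set0 => [|p /g0 /set0Pn[i]]; last by have := I0 i.
  by rewrite eq_card0 // => i; have := I0 i.
pose c p := odflt i0 [pick i in g p].
exists (~: (c @: P)) => [|p pP]; first by rewrite setCK leq_imset_card.
apply/negP => /subsetP gJ.
have cg : c p \in g p.
  rewrite /c; case: pickP => // g00.
  by have /set0Pn[i] := g0 p pP; rewrite g00.
by have := gJ _ cg; rewrite inE imset_f.
Qed.

(** * Expected number of forbidden pairs *)

(* [l] bounds the order [v] and [2 ^ l] the number [m] of hyperedges of the
   forbidden hypergraphs; the last condition is
   [v + (1 + 2/k - r)(m - 1) < r] multiplied by [k]. *)
Definition forbidden_size (r k l v m : nat) : bool :=
  [&& (v <= l)%N, (m <= 2 ^ l)%N, (1 < m)%N &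
      (k * v + k.+2 * m.-1 < k * (r * m))%N].

Definition forbidden_pairs (r k l : nat) (X I : finType)
    (f : {ffun I -> {ffun 'I_r -> X}}) : {set {set X} * {set I}} :=
  [set p : {set X} * {set I} | forbidden_size r k l #|p.1| #|p.2| &&
     [forall j in p.2, f j \in [set x | x \in ffun_on (mem p.1)]]].

(** Union bound for one size: up to constants the binomials are at most [s ^ (k * v)] and
    [s ^ (k.+1 * m)], and confining [m] tuples to [v] vertices saves a factor
    [s ^ (k * (r * m))]. *)
Lemma forbidden_size_count (r k l n s v m : nat) :
  (0 < n ^ r)%N -> (0 < s)%N -> forbidden_size r k l v m ->
  ('C(n * s ^ k, v) * 'C(s ^ k.+1, m) *
     ((v ^ r) ^ m * ((n * s ^ k) ^ r) ^ (s ^ k.+1 - m)) * s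
   <= (n.+1 ^ l * l.+1 ^ (r * 2 ^ l)) * s ^ k
      * ((n * s ^ k) ^ r) ^ (s ^ k.+1))%N.
Proof.
move=> n0 s0 /and4P[vl ml m1 lt_vm].
have [|lt_Mm] := leqP m (s ^ k.+1); last by rewrite (bin_small lt_Mm) muln0.
move=> le_mM.
rewrite -{3}(subnK le_mM) expnD.
set P := ((n * s ^ k) ^ r)%N; set b := (P ^ _)%N.
suff le_main : ('C(n * s ^ k, v) * 'C(s ^ k.+1, m) * (v ^ r) ^ m * s
    <= n.+1 ^ l * l.+1 ^ (r * 2 ^ l) * s ^ k * P ^ m)%N.
  by have := leq_mul le_main (leqnn b); congr (_ <= _)%N; ring.
clear b.
(* Having [k.+2] in place of [k.+1] in the size condition gains [m - 1 >= 1], which pays for the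
   extra factor [s]. *)
have le_exp : (k * v + k.+1 * m + 1 <= k + k * (r * m))%N.
  by case: m m1 lt_vm {ml le_mM} => [|[|m]] //=; nia.
have le_s : (s ^ (k * v) * s ^ (k.+1 * m) * s <= s ^ k * s ^ (k * (r * m)))%N.
  by rewrite -{3}(expn1 s) -!expnD leq_pexp2l.
have bin1 : ('C(n * s ^ k, v) <= n.+1 ^ l * s ^ (k * v))%N.
  apply: leq_trans (leq_bin_exp _ _) _.
  rewrite expnMn -expnM leq_mul2r; apply/orP; right.
  by apply: (@leq_trans (n.+1 ^ v)); [rewrite leq_expl|rewrite leq_pexp2l].
have bin2 : ('C(s ^ k.+1, m) <= s ^ (k.+1 * m))%N.
  by apply: leq_trans (leq_bin_exp _ _) _; rewrite -expnM.
have vr : ((v ^ r) ^ m <= l.+1 ^ (r * 2 ^ l))%N.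
  rewrite -expnM; apply: (@leq_trans (l.+1 ^ (r * m))).
    by rewrite leq_expl // ltnW.
  by rewrite leq_pexp2l // leq_mul2l ml orbT.
have nr : (0 < (n ^ r) ^ m)%N by rewrite expn_gt0 n0.
have -> : (P ^ m = (n ^ r) ^ m * s ^ (k * (r * m)))%N.
  by rewrite /P !expnMn -!expnM.
apply: (@leq_trans (n.+1 ^ l * s ^ (k * v) * s ^ (k.+1 * m)
                      * l.+1 ^ (r * 2 ^ l) * s)%N).
  by rewrite leq_mul2r; apply/orP; right; rewrite !leq_mul.
apply: (@leq_trans ((n.+1 ^ l * l.+1 ^ (r * 2 ^ l))
                     * (s ^ k * s ^ (k * (r * m))))%N).
  by apply: leq_trans (leq_mul (leqnn _) le_s); apply: eq_leq; ring.
by rewrite mulnA leq_mul2l leq_pmull ?orbT.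
Qed.

(** Double counting: the number of outcomes confined by a pair depends only on its two sizes, and at
    most [l.+1 * (2 ^ l).+1] sizes occur. *)
Lemma sum_card_forbidden_pairs (r k l n s : nat) (X I : finType) :
  #|X| = (n * s ^ k)%N -> #|I| = (s ^ k.+1)%N ->
  (0 < n ^ r)%N -> (0 < s)%N ->
  ((\sum_(f : {ffun I -> {ffun 'I_r -> X}}) #|forbidden_pairs k l f|) * s
   <= (l.+1 * (2 ^ l).+1 * (n.+1 ^ l * l.+1 ^ (r * 2 ^ l))) * s ^ k
      * #|{: {ffun I -> {ffun 'I_r -> X}}}|)%N.
Proof.
move=> cX cI n0 s0.
(* [inord] is faithful where it matters, as [forbidden_size] keeps both sizes in range. *)
pose size_at (p : {set X} * {set I}) : 'I_l.+1 * 'I_(2 ^ l).+1 :=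
  (inord #|p.1|, inord #|p.2|).
pose c v m := ((v ^ r) ^ m * (#|X| ^ r) ^ (#|I| - m))%N.
have cT : #|{: {ffun I -> {ffun 'I_r -> X}}}| = ((#|X| ^ r) ^ #|I|)%N.
  by rewrite !card_ffun card_ord.
have -> : (\sum_(f : {ffun I -> {ffun 'I_r -> X}}) #|forbidden_pairs k l f|
    = \sum_(p : {set X} * {set I} | forbidden_size r k l #|p.1| #|p.2|)
        c #|p.1| #|p.2|)%N.
  under eq_bigr do rewrite -sum1_card /forbidden_pairs.
  under eq_bigr do (under eq_bigl do rewrite inE; rewrite big_mkcondr /=).
  rewrite exchange_big /=; apply: eq_bigr => p _.
  rewrite -big_mkcond sum1dep_card card_ffun_maps_to card_ffun card_ord.
  by rewrite cardsE card_ffun_on card_ord.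
rewrite (partition_big size_at xpredT) //= big_distrl /=.
apply: (@leq_trans (\sum_(vm : 'I_l.+1 * 'I_(2 ^ l).+1)
   (n.+1 ^ l * l.+1 ^ (r * 2 ^ l)) * s ^ k
      * #|{: {ffun I -> {ffun 'I_r -> X}}}|)%N); last first.
  by rewrite sum_nat_const card_prod !card_ord !mulnA.
apply: leq_sum => -[v m] _.
case: (boolP (forbidden_size r k l v m)) => [bad|nbad]; last first.
  rewrite big1 // => p /andP[/and4P[le1 le2 lt1 lt2] /eqP[ev em]].
  case/negP: nbad; rewrite -ev -em /= !inordK ?ltnS //.
  exact/and4P.
rewrite cT cX cI; apply: leq_trans (forbidden_size_count n0 s0 bad).
rewrite leq_mul2r; apply/orP; right.
rewrite -cX -cI -/(c v m).
rewrite -!card_draws -cardsX -sum_nat_const big_mkcond [leqRHS]big_mkcond.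
apply: leq_sum => p _; case: ifP => // /andP[/and4P[le1 le2 _ _] /eqP[ev em]].
move/(congr1 val): ev; move/(congr1 val): em; rewrite /=.
rewrite !inordK ?ltnS // => em ev.
by rewrite !inE em ev !eqxx.
Qed.

(** * Families with few hits and the choice of an outcome *)

(* Markov's inequality for [2 ^ - hits]: each summand is at least 1 as soon as
   [B u] is hit at most [d] times. *)
Lemma sum_few_hits (R : realFieldType) (I T K : finType) (B : K -> {set T})
    (q : R) (c s d : nat) :
  #|I| = (s * d)%N -> (0 < d)%N -> (#|K| <= 2 ^ (c * d))%N ->
  0 <= q -> q <= 1 -> 4 * 2 ^+ c.+1 * (1 - q / 2) ^+ s <= 1 ->
  \sum_(f : {ffun I -> T}) \sum_(u | q * #|T|%:R <= #|B u|%:R)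
     2 ^+ d * (2^-1 : R) ^+ #|[set i | f i \in B u]|
    <= #|{: {ffun I -> T}}|%:R / 4.
Proof.
move=> cI d0 cK q0 q1 small; rewrite exchange_big /=.
set N : R := #|{: {ffun I -> T}}|%:R.
have NE : N = #|T|%:R ^+ #|I| by rewrite /N card_ffun natrX.
have p0 : 0 <= 1 - q / 2 by lra.
apply: (@le_trans _ _ (\sum_(u : K) 2 ^+ d * ((1 - q / 2) ^+ #|I| * N))).
  rewrite big_mkcond; apply: ler_sum => u _; case: ifP => [big_u|_]; last first.
    by rewrite !mulr_ge0 ?exprn_ge0 ?ler0n.
  rewrite -mulr_sumr sum_halfX_hits ler_wpM2l ?exprn_ge0 // NE -exprMn.
  have BT : #|B u|%:R <= #|T|%:R :> R by rewrite ler_nat max_card.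
  have B0 : 0 <= #|B u|%:R :> R by rewrite ler0n.
  by apply: lerXn2r; rewrite ?nnegrE ?mulr_ge0 ?ler0n //; lra.
rewrite sumr_const -[leLHS]mulr_natl.
have cKR : #|K|%:R <= (2 ^+ c) ^+ d :> R by rewrite -exprM -natrX ler_nat.
have N0 : 0 <= N by rewrite ler0n.
(* The values of [#|I|] and the bound on [#|K|] bound the total by a [d]-th power times [N]; by
   [small] the base is at most 1/4. *)
apply: (@le_trans _ _ ((2 ^+ c.+1 * (1 - q / 2) ^+ s) ^+ d * N)).
  rewrite cI exprM exprS !exprMn [2 ^+ d * _ ^+ d]mulrC.
  rewrite -[leRHS]mulrA -[leRHS]mulrA.
  by apply: ler_wpM2r => //; rewrite !mulr_ge0 ?exprn_ge0.
rewrite mulrC; apply: ler_wpM2l => //.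
set x := 2 ^+ _ * _ in small *.
have x0 : 0 <= x by rewrite mulr_ge0 ?exprn_ge0.
have x4 : x <= 4^-1 by move: small; rewrite -mulrA -/x; lra.
by rewrite -(prednK d0) exprS -[leRHS]mulr1; apply: ler_pM;
  rewrite ?exprn_ge0 // exprn_ile1 //; lra.
Qed.

(** First moment: the forbidden count divided by [s ^ k] and the total weight [few] average at most
    1/4 each, so some outcome has sum below 1, and both terms are nonnegative. *)
Lemma exists_hitting_few_forbidden (R : realFieldType) (r k l n s c : nat)
    (X I K : finType) (B : K -> {set {ffun 'I_r -> X}}) (q : R) :
  #|X| = (n * s ^ k)%N -> #|I| = (s ^ k.+1)%N -> (#|K| <= 2 ^ (c * s ^ k))%N ->
  (0 < n ^ r)%N -> 0 <= q -> q <= 1 ->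
  (4 * (l.+1 * (2 ^ l).+1 * (n.+1 ^ l * l.+1 ^ (r * 2 ^ l))) <= s)%N ->
  4 * 2 ^+ c.+1 * (1 - q / 2) ^+ s <= 1 ->
  exists2 f : {ffun I -> {ffun 'I_r -> X}},
    (#|forbidden_pairs k l f| < s ^ k)%N &
    forall u, q * #|{: {ffun 'I_r -> X}}|%:R <= #|B u|%:R ->
      (s ^ k < #|[set i | f i \in B u]|)%N.
Proof.
move=> cX cI cK n0 q0 q1; set C := (l.+1 * _ * _)%N => Cs small.
have C0 : (0 < C)%N by rewrite !muln_gt0 !expn_gt0.
have s0 : (0 < s)%N by lia.
have d0 : (0 < s ^ k)%N by rewrite expn_gt0 s0.
have dR : 0 < (s ^ k)%:R :> R by rewrite ltr0n.
pose Om := {ffun 'I_r -> X}.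
pose few (f : {ffun I -> Om}) : R :=
  \sum_(u | q * #|{: Om}|%:R <= #|B u|%:R)
     2 ^+ (s ^ k) * 2^-1 ^+ #|[set i | f i \in B u]|.
have few_ge0 f : 0 <= few f.
  by apply: sumr_ge0 => u _; rewrite mulr_ge0 ?exprn_ge0 // invr_ge0.
set N : nat := #|{: {ffun I -> Om}}|.
have N0 : (0 < N)%N.
  by rewrite /N card_ffun card_ffun card_ord cX expnMn expn_gt0 muln_gt0 n0
    (expn_gt0 (s ^ k)) d0.
have [f] : exists f : {ffun I -> Om},
    #|forbidden_pairs k l f|%:R / (s ^ k)%:R + few f < 1.
  apply: exists_lt1_of_sum_lt; rewrite big_split /= -mulr_suml -natr_sum.
  have le1 := sum_card_forbidden_pairs l cX cI n0 s0.
  have le2 : \sum_f few f <= N%:R / 4.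
    by apply: (@sum_few_hits R I Om K B q c s (s ^ k)); rewrite ?cI ?expnS.
  suff le3 : (\sum_(f : {ffun I -> Om}) #|forbidden_pairs k l f|)%:R
      / (s ^ k)%:R <= N%:R / 4 :> R.
    have NR : 0 < N%:R :> R by rewrite ltr0n.
    by rewrite -/N; lra.
  rewrite ler_pdivrMr // mulrAC ler_pdivlMr // -!natrM ler_nat.
  rewrite -(leq_pmul2r s0) mulnAC (leq_trans (leq_mul le1 (leqnn 4))) //.
  rewrite -/C -/N [leqRHS]mulnC.
  by apply: leq_trans (leq_mul Cs (leqnn _)); apply: eq_leq; ring.
move=> lt1; exists f => [|u big_u].
  rewrite -(ltr_nat R) -[ltRHS]mul1r -ltr_pdivrMr //.
  by have := few_ge0 f; lra.
have : few f < 1.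
  by apply: le_lt_trans lt1; rewrite lerDr divr_ge0 ?ler0n.
(* A family with at most [s ^ k] hits would alone contribute at least 1 to [few f]. *)
rewrite /few (bigD1 u) //= ltnNge => lt_few; apply/negP => le_hits.
move: lt_few; apply/negP; rewrite -leNgt.
rewrite -[leLHS]addr0; apply: lerD; last first.
  by apply: sumr_ge0 => v _; rewrite mulr_ge0 ?exprn_ge0 // invr_ge0.
rewrite exprVn ler_pdivlMr ?exprn_gt0 // mul1r.
by rewrite ler_weXn2l // ler1n.
Qed.

(** * Sample size and the sampled hypergraph *)

Lemma card_ffun_family (aT rT : finType) (U : aT -> {set rT}) :
  #|[set x : {ffun aT -> rT} | x \in family (fun i => mem (U i))]|
    = (\prod_i #|U i|)%N.
Proof. by rewrite cardsE card_family foldrE big_map big_enum. Qed.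

Lemma card_hypergraph_le (W : finType) (F : hypergraph W) :
  (#|F| <= 2 ^ #|W|)%N.
Proof.
rewrite -cardsT -card_powerset; apply: subset_leq_card.
by apply/subsetP => e _; rewrite inE subsetT.
Qed.

(** Bernoulli's inequality with [x = q / 2]: once [s] exceeds [2 * |C| / q], the factor
    [1 + s * (q / 2)] is at least [C]. *)
Lemma exists_sample_size (R : realType) (q C : R) (D : nat) :
  0 < q -> q <= 1 ->
  exists2 s : nat, (D <= s)%N & C * (1 - q / 2) ^+ s <= 1.
Proof.
move=> q0 q1; pose a := `|C| * 2 / q.
have a0 : 0 <= a by rewrite divr_ge0 ?mulr_ge0 // ltW.
exists (maxn D (Num.bound a)); first exact: leq_maxl.
set s := maxn _ _.
have lt_as : a < s%:R.
  by apply: lt_le_trans (archi_boundP a0) _; rewrite ler_nat leq_maxr.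
have le_C : C <= 1 + s%:R * (q / 2).
  move: lt_as; rewrite /a ltr_pdivrMr // => lt_as.
  have := ler_norm C; lra.
apply: le_trans (@expr_onem_bernoulli R (q / 2) s _ _); [|lra|lra].
rewrite mulrC; apply: ler_wpM2l => //.
by rewrite exprn_ge0 //; lra.
Qed.

Definition sample_edges (r : nat) (X I : finType)
    (f : {ffun I -> {ffun 'I_r -> X}}) (J : {set I}) : hypergraph X :=
  [set e in [set f j @: [set: 'I_r] | j in J] | #|e| == r].

Lemma uniform_sample_edges (r : nat) (X I : finType)
    (f : {ffun I -> {ffun 'I_r -> X}}) (J : {set I}) : uniform r (sample_edges f J).
Proof. by move=> e; rewrite inE => /andP[_ /eqP]. Qed.

(** Disjointness of the [U i] makes the tuple injective, so its image passes the size test and meets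
    [U i] only in [f j i]. *)
Lemma sample_edges_hit (r : nat) (X I : finType)
    (f : {ffun I -> {ffun 'I_r -> X}}) (J : {set I}) (U : 'I_r -> {set X}) (j : I) :
  j \in J -> (forall i, f j i \in U i) ->
  (forall i1 i2 x, x \in U i1 -> x \in U i2 -> i1 = i2) ->
  exists2 e, e \in sample_edges f J & forall i, #|e :&: U i| = 1%N.
Proof.
move=> jJ fU disjU.
have inj_f : injective (f j).
  by move=> i1 i2 eq_f; apply: (disjU _ _ (f j i1)); rewrite // eq_f.
exists (f j @: setT).
  by rewrite inE imset_f //= card_imset // cardsT card_ord.
move=> i; apply/eqP/cards1P; exists (f j i); apply/setP => x; rewrite !inE.
apply/andP/eqP => [[/imsetP[i' _ ->] xU]|->]; last by rewrite imset_f.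
by rewrite (disjU _ _ _ xU (fU i')).
Qed.

(** A copy of [F] yields a forbidden pair inside [J]: the image of [W] and one chosen index per
    hyperedge, distinct because [g] is injective. *)
Lemma sample_edges_sparse (r : nat) (X I : finType)
    (f : {ffun I -> {ffun 'I_r -> X}})
    (k l : nat) (J : {set I}) (W : finType) (F : hypergraph W) :
  (forall p, p \in forbidden_pairs k l f -> ~~ (p.2 \subset J)) ->
  forbidden_size r k l #|W| #|F| -> ~ contains (sample_edges f J) F.
Proof.
move=> sparse bad [g [inj_g gF]].
have preim e : e \in F -> exists j, (j \in J) && (g @: e == f j @: [set: 'I_r]).
  move/gF; rewrite inE => /andP[/imsetP[j jJ ->] _]; exists j.
  by rewrite jJ eqxx.
have [F0|[e0 e0F]] := set_0Vmem F.
  by move: bad; rewrite F0 cards0 /forbidden_size /= !andbF.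
have [j0 _] := preim _ e0F.
pose h (e : {set W}) :=
  odflt j0 [pick j | (j \in J) && (g @: e == f j @: [set: 'I_r])].
have hP e : e \in F -> h e \in J /\ g @: e = f (h e) @: [set: 'I_r].
  rewrite /h => eF; case: pickP => [j /andP[jJ /eqP->] //|none].
  by have [j] := preim e eF; rewrite none.
have inj_h : {in F &, injective h}.
  move=> e1 e2 /hP[_ eq1] /hP[_ eq2] eqh.
  by apply: (imset_inj inj_g); rewrite eq1 eq2 eqh.
have /negP[] : ~~ (h @: F \subset J).
  apply: (sparse (g @: setT, h @: F)).
  rewrite inE /= (card_in_imset inj_h) (card_imset _ inj_g) cardsT bad /=.
  apply/forall_inP => j /imsetP[e eF ->]; rewrite inE; apply/ffun_onP => i.
  have [_ eq_e] := hP e eF.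
  have : f (h e) i \in g @: e by rewrite eq_e imset_f.
  by case/imsetP => w _ ->; rewrite imset_f.
by apply/subsetP => j /imsetP[e /hP[hJ _] ->].
Qed.

(** As [m > 1], lowering [gamma] to [2 / k] keeps the inequality; multiplying by [k] makes it
    integral. *)
Lemma forbidden_size_of_sparse (R : realType) (gamma : R) (r k l v m : nat) :
  2 < gamma * k%:R -> (v <= l)%N -> (m <= 2 ^ v)%N -> (1 < m)%N ->
  v%:R + (1 + gamma - r%:R) * (m%:R - 1) < r%:R ->
  forbidden_size r k l v m.
Proof.
move=> k2 vl mv m1 sparse; apply/and4P; split => //.
  by apply: leq_trans mv _; rewrite leq_pexp2l.
case: m m1 sparse {mv} => // m m1 /=; rewrite -natr1 addrK => sparse.
have k0 : 0 < k%:R :> R.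
  by rewrite lt0r ler0n andbT; apply/eqP => k0; move: k2; rewrite k0; lra.
rewrite -(ltr_nat R) natrD !natrM -!natr1.
have m0 : 0 < m%:R :> R by rewrite ltr0n.
have : k%:R * (v%:R + (1 + gamma - r%:R) * m%:R) < k%:R * r%:R.
  by rewrite ltr_pM2l.
have : 2 * m%:R < gamma * k%:R * m%:R by rewrite ltr_pM2r.
rewrite -!natr1; nra.
Qed.

(** * Choice of parameters and conclusion *)

(* The set {1, ..., t} is represented by 'I_t. The edgeless F are excluded in
   the second property: every nonempty G contains a single vertex, for which
   v = 1, m = 0 and v + (1 + gamma - r) (m - 1) = r - gamma < r. *)
Theorem theorem6p1 (R : realType) (r n : nat) (V : finType)
    (H : hypergraph V) (gamma : R) (l : nat) :
  #|V| = n -> uniform r H ->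
  0 < gamma -> gamma < 1 -> (0 < l)%N ->
  exists t : nat, (0 < t)%N /\
  exists G : hypergraph (V * 'I_t)%type,
    [/\ uniform r G,
        (forall (a : 'I_r -> V) (U : 'I_r -> {set V * 'I_t}),
           [set a i | i : 'I_r] \in H ->
           (forall i : 'I_r, U i \subset setX [set a i] [set: 'I_t]) ->
           (forall i : 'I_r, gamma * t%:R <= #|U i|%:R) ->
           exists2 e : {set V * 'I_t},
             e \in G & forall i : 'I_r, #|e :&: U i| = 1%N)
      & (forall (W : finType) (F : hypergraph W),
           (0 < #|F|)%N ->
           (#|W| <= l)%N ->
           #|W|%:R + (1 + gamma - r%:R) * (#|F|%:R - 1) < r%:R ->
           ~ contains G F)].
Proof.
move=> cV unifH g0 g1 _.
(* A hyperedge of [H] forces [n >= r], hence [n ^ r > 0]; the empty [H] is therefore treated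
   separately. *)
have [H0|[e0 e0H]] := set_0Vmem H.
  exists 1%N; split=> //; exists set0; split=> [e|a U|W F F0 _ _ [g [_ gF]]].
  - by rewrite inE.
  - by rewrite H0 inE.
  - by case/card_gt0P: F0 => e /gF; rewrite inE.
have n0 : (0 < n ^ r)%N.
  have [->|r0] := posnP r; first by rewrite expn0.
  by rewrite expn_gt0 -cV (leq_trans r0) // -(unifH _ e0H) max_card.
pose k := Num.bound (2 / gamma).
have k2 : 2 < gamma * k%:R.
  by rewrite mulrC -ltr_pdivrMr // archi_boundP // divr_ge0 // ltW.
(* Each [U i] holds a share of at least [gamma / n] of all vertices; [n.+1] avoids division by zero
   when [n = 0]. *)
pose q : R := (gamma / n.+1%:R) ^+ r.
have gn0 : 0 < gamma / n.+1%:R by rewrite divr_gt0 ?ltr0n.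
have gn1 : gamma / n.+1%:R <= 1.
  by rewrite ler_pdivrMr ?ltr0n // mul1r -natr1; have := ler0n R n; lra.
have q0 : 0 < q by rewrite exprn_gt0.
have q1 : q <= 1 by rewrite exprn_ile1 // ltW.
have [s les small] := exists_sample_size (4 * 2 ^+ (n * r).+1)
  (4 * (l.+1 * (2 ^ l).+1 * (n.+1 ^ l * l.+1 ^ (r * 2 ^ l))))%N q0 q1.
have s0 : (0 < s)%N by apply: leq_trans les; rewrite !muln_gt0 !expn_gt0.
pose t := (s ^ k)%N.
have t0 : (0 < t)%N by rewrite expn_gt0 s0.
exists t; split=> //.
have cX : #|{: V * 'I_t}| = (n * s ^ k)%N by rewrite card_prod cV card_ord.
pose B (U : {ffun 'I_r -> {set V * 'I_t}}) :=
  [set x : {ffun 'I_r -> V * 'I_t} | x \in family (fun i => mem (U i))].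
have cK : (#|{: {ffun 'I_r -> {set V * 'I_t}}}| <= 2 ^ (n * r * s ^ k))%N.
  by rewrite card_ffun card_ord -cardsT -powersetT card_powerset cardsT cX
             -expnM mulnAC.
have [f few hits] := exists_hitting_few_forbidden B cX
  (card_ord (s ^ k.+1)) cK n0 (ltW q0) q1 les small.
have [J cJ sparse] : exists2 J : {set 'I_(s ^ k.+1)},
    (#|~: J| <= #|forbidden_pairs k l f|)%N &
    forall p, p \in forbidden_pairs k l f -> ~~ (p.2 \subset J).
  apply: delete_one_each => p; rewrite inE => /andP[/and4P[_ _ p2 _] _].
  by rewrite -card_gt0 ltnW.
exists (sample_edges f J); split.
- exact: uniform_sample_edges.
- move=> a U aH UV Ularge.
  have inj_a : injective a.
    have := unifH _ aH; rewrite -[in RHS](card_ord r) => /eqP/imset_injP inj_a.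
    by move=> i1 i2; exact: inj_a.
  have fstU i x : x \in U i -> x.1 = a i.
    by move/(subsetP (UV i)); rewrite !inE andbT => /eqP.
  have : q * #|{: {ffun 'I_r -> V * 'I_t}}|%:R <= #|B (finfun U)|%:R.
    rewrite card_ffun_family natr_prod card_ffun card_ord cX -/t natrX.
    rewrite -exprMn -[X in _ ^+ X]card_ord -prodr_const.
    apply: ler_prod => i _; rewrite ffunE.
    rewrite mulr_ge0 ?ler0n ?(ltW gn0) //=.
    apply: le_trans (Ularge i); rewrite natrM mulrA ler_wpM2r ?ler0n //.
    rewrite mulrAC ler_pdivrMr ?ltr0n // ler_wpM2l ?(ltW g0) //.
    by rewrite ler_nat.
  move/hits => many.
  have [j jJ jU] : exists2 j, j \in J & f j \in B (finfun U).
    apply/exists_inP; apply: contraTT many => /exists_inPn none.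
    rewrite -leqNgt (leq_trans _ (ltnW (leq_ltn_trans cJ few))) //.
    apply: subset_leq_card; apply/subsetP => j; rewrite inE => jU.
    by rewrite inE; apply/negP => /none; rewrite jU.
  apply: (sample_edges_hit jJ) => [i|i1 i2 x /fstU eq1 /fstU eq2].
    by move: jU; rewrite inE => /familyP/(_ i); rewrite ffunE.
  by apply: inj_a; rewrite -eq1 eq2.
- move=> W F F0 Wl sizeF.
  have [m1|m1] := ltnP 1 #|F|.
    apply: (sample_edges_sparse sparse).
    exact: (forbidden_size_of_sparse k2 Wl (card_hypergraph_le F) m1 sizeF).
  have F1 : #|F| = 1%N by apply/eqP; rewrite eqn_leq m1 F0.
  case=> g [inj_g gF]; case/card_gt0P: F0 => e /gF/uniform_sample_edges.
  rewrite card_imset // => ce; move: sizeF.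
  by rewrite F1 subrr mulr0 addr0 ltr_nat ltnNge -ce max_card.
Qed.
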